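(* Let $\Gamma^{\overline k}=\{T\in\mathrm{C}^\times: T\,\mathrm{C}^{\overline k}\,T^{-1}\subseteq\mathrm{C}^{\overline k}\}$ for $k=0,1,2,3$. <ul> <li>If $n\ge4$ and $n\equiv0\pmod 4$: $\mathrm{Q}=\Gamma^{\overline1}=\Gamma^{\overline3}$ and $\mathrm{Q}'=\Gamma^{\overline0}=\Gamma^{\overline2}$, and $\mathrm{Q}\neq\mathrm{Q}'$.</li> <li>If $n\ge4$ and $n\equiv1,2,3\pmod4$: $\mathrm{Q}=\Gamma^{\overline0}=\Gamma^{\overline1}=\Gamma^{\overline2}=\Gamma^{\overline3}$.</li> <li>If $n=2$: $\Gamma^{\overline0}=\mathrm{C}^\times$, and $\Gamma^{\overline1}=\Gamma^{\overline2}=\mathrm{Q}=\mathrm{P}=\mathrm{C}^{\times(0)}\cup\mathrm{C}^{\times(1)}$, and this group is different from $\mathrm{C}^\times$.</li> <li>If $n=3$: $\Gamma^{\overline0}=\Gamma^{\overline3}=\mathrm{C}^\times$, and $\Gamma^{\overline1}=\Gamma^{\overline2}=\mathrm{Q}=\mathrm{P}=\mathrm{Z}^\times\mathrm{C}^{\times(0)}$, and this group is different from $\mathrm{C}^\times$.</li> </ul> Consequently, for all $n\ge2$, $\Gamma^{\overline1}\subseteq\Gamma^{\overline k}$ for $k=0,1,2,3$, and $$\Gamma^{\overline1}=\mathrm{Q}=\{T\in\mathrm{C}^\times:\ T\,\mathrm{C}^{\overline k}\,T^{-1}\subseteq\mathrm{C}^{\overline k}\ \text{for}\ k=0,1,2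,3\}.$$
   Context: Let $\mathrm{C}$ be either the real Clifford algebra $C\ell_{p,q}$ with $p+q=n$, or the complex Clifford algebra $C\ell(\mathbb{C}^n)$, with $n\ge 2$. It has identity $e$ and generators $e_1,\dots,e_n$ satisfying $e_ae_b+e_be_a=2\eta_{ab}e$. In the real case $\eta=\mathrm{diag}(1,\dots,1,-1,\dots,-1)$ with $p$ entries $+1$ and $q$ entries $-1$. In the complex case $\eta=I_n$. $\mathrm{C}^k$ is the grade-$k$ subspace, spanned by the products $e_{a_1}\cdots e_{a_k}$ with $a_1<\dots<a_k$. For $m=0,1,2,3$ let $\mathrm{C}^{\overline m}=\bigoplus_{k\equiv m\pmod4}\mathrm{C}^k$. The even subspace is $\mathrm{C}^{(0)}=\bigoplus_{k\text{ even}}\mathrm{C}^k$ and the odd subspace is $\mathrm{C}^{(1)}=\bigoplus_{k\text{ odd}}\mathrm{C}^k$. The reversion $U\mapsto\tilde U$ is the linear anti-automorphism acting on $\mathrm{C}^k$ as $(-1)^{k(k-1)/2}$. For $S\subseteq\mathrm{C}$, $S^\times$ is the set of elements of $S$ invertible in $\mathrm{C}$, and $\mathrm{C}^{\times(j)}:=(\mathrm{C}^{(j)})^\times$. $\mathrm{Z}$ is the center: $\mathrm{Z}=\mathrm{C}^0$ for $n$ even and $\mathrm{Z}=\mathrm{C}^0\oplus\mathrm{C}^n$ for $n$ odd. Define: <ul> <li>$\mathrm{P}:=\mathrm{Z}^\times(\mathrm{C}^{\times(0)}\cup\mathrm{C}^{\times(1)})=\{WT: W\in\mathrm{Z}^\times,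 T\in\mathrm{C}^{\times(0)}\cup\mathrm{C}^{\times(1)}\}$;</li> <li>$\mathrm{Q}:=\{T\in\mathrm{P}:\tilde TT\in\mathrm{Z}^\times\}$;</li> <li>$\mathrm{Q}':=\{T\in\mathrm{P}:\tilde TT\in(\mathrm{C}^0\oplus\mathrm{C}^n)^\times\}$.</li> </ul> *)

(* Defs.v *)
(* Clifford algebras with a diagonal metric, built on the
   standard basis { e_A : A subset of {0..n-1} } (e_A = e_{a1}...e_{ak},
   a1 < ... < ak, e_set0 = identity e). *)
From HB Require Import structures.
From mathcomp Require Import all_boot all_order all_algebra.
From mathcomp Require Import complex reals.
Set Implicit Arguments. Unset Strict Implicit. Unset Printing Implicit Defensive.
Import Order.TTheory GRing.Theory Num.Theory.
Local Open Scope ring_scope.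

Section Clifford.
Variables (K : fieldType) (n : nat) (eta : 'I_n -> K).
(* eta i = eta_{ii}; the metric is diagonal: e_i e_j + e_j e_i = 2 eta_{ij} e *)

(* Elements of the Clifford algebra: coordinate functions on the basis blades. *)
Definition clif := {ffun {set 'I_n} -> K}.

Definition symdiff (A B : {set 'I_n}) := (A :\: B) :|: (B :\: A).

(* sign arising from reordering e_A e_B : (-1)^#{(a,b) : a in A, b in B, a > b} *)
Definition csign (A B : {set 'I_n}) : K :=
  (-1) ^+ #|[set ab : 'I_n * 'I_n |
             [&& ab.1 \in A, ab.2 \in B & (nat_of_ord ab.2 < nat_of_ord ab.1)%N]]|.

(* e_A e_B = csign A B * (prod_{i in A cap B} eta_i) e_{A symdiff B} *)
Definition cmul (U V : clif) : clif :=
  [ffun C => \sum_(A : {set 'I_n}) \sum_(B : {set 'I_n} | symdiff A B == C)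
                U A * V B * csign A B * \prod_(i in A :&: B) eta i].

Definition cone : clif := [ffun A => if A == set0 then 1 else 0].

Definition cunit (U : clif) : Prop :=
  exists V, cmul U V = cone /\ cmul V U = cone.

(* reversion: acts on C^k by (-1)^(k(k-1)/2) = (-1)^'C(k,2) *)
Definition crev (U : clif) : clif := [ffun A : {set 'I_n} => (-1) ^+ 'C(#|A|, 2) * U A].

Definition grade_mod4 (m : nat) (U : clif) : Prop :=
  forall A : {set 'I_n}, (#|A| %% 4 != m)%N -> U A = 0.
Definition even_part (U : clif) : Prop :=
  forall A : {set 'I_n}, odd #|A| -> U A = 0.
Definition odd_part (U : clif) : Prop :=
  forall A : {set 'I_n}, ~~ odd #|A| -> U A = 0.
Definition grade0n (U : clif) : Prop :=
  forall A : {set 'I_n}, A != set0 -> A != [set: 'I_n] -> U A = 0.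
(* the center Z: C^0 for n even, C^0 (+) C^n for n odd *)
Definition center (U : clif) : Prop :=
  forall A : {set 'I_n}, A != set0 -> (~~ odd n \/ A != [set: 'I_n]) -> U A = 0.

Definition units_in (S : clif -> Prop) (U : clif) : Prop := S U /\ cunit U.

Definition Pgrp (U : clif) : Prop :=
  exists W T, units_in center W /\
    (units_in even_part T \/ units_in odd_part T) /\ U = cmul W T.
Definition Qgrp (T : clif) : Prop :=
  Pgrp T /\ units_in center (cmul (crev T) T).
Definition Q'grp (T : clif) : Prop :=
  Pgrp T /\ units_in grade0n (cmul (crev T) T).

(* T C^{overline k} T^{-1} subseteq C^{overline k} (T^{-1} being any two-sided
   inverse of T; it is unique) *)
Definition preserves (k : nat) (T : clif) : Prop :=
  forall Ti, cmul T Ti = cone -> cmul Ti T = cone ->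
  forall U, grade_mod4 k U -> grade_mod4 k (cmul (cmul T U) Ti).

Definition Gamma (k : nat) (T : clif) : Prop := cunit T /\ preserves k T.

Definition evenodd_units (T : clif) : Prop :=
  units_in even_part T \/ units_in odd_part T.
Definition Zeven_units (U : clif) : Prop :=
  exists W T, units_in center W /\ units_in even_part T /\ U = cmul W T.

End Clifford.

Definition seteq {T : Type} (S1 S2 : T -> Prop) : Prop := forall x, S1 x <-> S2 x.
Definition subset {T : Type} (S1 S2 : T -> Prop) : Prop := forall x, S1 x -> S2 x.

Definition Theorem11_for (K : fieldType) (n : nat) (eta : 'I_n -> K) : Prop :=
  let G := Gamma eta in
  let Q := Qgrp eta in
  let Q' := Q'grp eta in
  let P := Pgrp eta in
  let Cx := cunit eta in
  [/\ ((4 <= n)%N -> (n %% 4)%N = 0%N ->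
        [/\ seteq Q (G 1%N), seteq Q (G 3%N), seteq Q' (G 0%N), seteq Q' (G 2%N)
          & ~ seteq Q Q']),
      ((4 <= n)%N -> (n %% 4)%N <> 0%N ->
        [/\ seteq Q (G 0%N), seteq Q (G 1%N), seteq Q (G 2%N) & seteq Q (G 3%N)]),
      (n = 2%N ->
        [/\ seteq (G 0%N) Cx,
            [/\ seteq (G 1%N) (evenodd_units eta), seteq (G 2%N) (evenodd_units eta),
                 seteq Q (evenodd_units eta) & seteq P (evenodd_units eta)]
          & ~ seteq (evenodd_units eta) Cx]),
      (n = 3%N ->
        [/\ seteq (G 0%N) Cx, seteq (G 3%N) Cx,
            [/\ seteq (G 1%N) (Zeven_units eta), seteq (G 2%N) (Zeven_units eta),
                seteq Q (Zeven_units eta) & seteq P (Zeven_units eta)]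
          & ~ seteq (Zeven_units eta) Cx]) &
      ((2 <= n)%N ->
        [/\ forall k, (k < 4)%N -> subset (G 1%N) (G k),
            seteq (G 1%N) Q
          & seteq Q (fun T => cunit eta T /\ forall k, (k < 4)%N -> preserves eta k T)])].

Definition eta_pq (R : realType) (p q : nat) : 'I_(p + q) -> R :=
  fun i => if (nat_of_ord i < p)%N then 1 else -1.
Definition eta_C (R : realType) (n : nat) : 'I_n -> R[i] := fun _ => 1.

(* Main.v *)
(* The reversion and the grade involution [ginvol] commute, and their joint
   eigenspaces are the four subspaces C^{overline k}. Hence, for a unit T,
   conjugation by T preserves C^{overline k} if and only if [reversion T * T] and
   [T^-1 * ginvol T] both centralize C^{overline k}. Since two blades commute or
   anticommute, this centralizer is spanned by blades: apart from small n it is Z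
   for odd k and C^0 + C^n for even k.

   Moreover T lies in P if and only if [T^-1 * ginvol T] lies in C^0 + C^n. For n
   even this means that [T^-1] conjugates the pseudoscalar [e_1 ... e_n] into
   C^0 + C^n, necessarily to plus or minus itself, so that T is even or odd; for n
   odd it is Hilbert 90 for the involution of Z. What remains of the condition on
   T is the one on [reversion T * T] which defines Q or Q'. *)
From HB Require Import structures.
Require Import Defs.
From mathcomp Require Import all_boot all_algebra falgebra.
From mathcomp Require Import complex reals zify.
Set Implicit Arguments. Unset Strict Implicit. Unset Printing Implicit Defensive.
Import GRing.Theory Num.Theory.
Local Open Scope ring_scope.

Lemma bin2D x y : 'C(x + y, 2) = ('C(x, 2) + 'C(y, 2) + x * y)%N.
Proof.
elim: x => [|x IHx]; first by rewrite add0n mul0n addn0.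
by rewrite addSn !binS IHx !bin1 mulSn; lia.
Qed.

Lemma modn4_eq m k : (k < 4)%N ->
  (m %% 4 == k)%N = (odd 'C(m, 2) == odd 'C(k, 2)) && (odd m == odd k).
Proof.
have odd_bin2_mul4 q : odd 'C(q * 4, 2) = false.
  by elim: q => // q IHq; rewrite mulSn bin2D 2!oddD IHq oddM.
rewrite {2 3}(divn_eq m 4) bin2D !oddD odd_bin2_mul4 !oddM !andbF /= addbF.
by have := ltn_pmod m (isT : 0 < 4)%N; case: (m %% 4)%N => [|[|[|[|]]]] // _;
  case: k => [|[|[|[|]]]].
Qed.

Lemma exists_subset_card (T : finType) (A : {set T}) m : (m <= #|A|)%N ->
  exists2 B : {set T}, B \subset A & #|B| = m.
Proof.
rewrite -bin_gt0 -cards_draws card_gt0 => /set0Pn[B].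
by rewrite inE => /andP[BA /eqP Bm]; exists B.
Qed.

Lemma card_nonempty_proper (T : finType) (A : {set T}) :
  A != set0 -> A != setT -> (0 < #|A| < #|T|)%N.
Proof.
by move=> A0 AT; rewrite card_gt0 A0 -cardsT proper_card // properT.
Qed.

Lemma eq_conj_comm (R : unitRingType) (x y u : R) :
    x \is a GRing.unit -> y \is a GRing.unit ->
  x * u / x = y * u / y <-> GRing.comm (y^-1 * x) u.
Proof.
move=> xu yu; split=> [xuy|].
  by rewrite /GRing.comm -mulrA -[x * u](mulrVK xu) xuy !mulrA mulVr ?mul1r.
rewrite /GRing.comm -mulrA => /(congr1 ( *%R y)); rewrite mulrA mulrV // mul1r => ->.
by rewrite !mulrA mulrK.
Qed.

Lemma alg_unit (K : fieldType) (A : unitAlgType K) (c : K) :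
  c != 0 -> c%:A \is a @GRing.unit A.
Proof. by move=> c0; rewrite scaler_unit ?unitr1 ?unitfE. Qed.

Lemma exists_sqr_mul_neq1 (K : fieldType) (a : K) : (2 : K) != 0 -> (3 : K) != 0 ->
  exists2 c : K, c != 0 & c ^+ 2 * a != 1.
Proof.
move=> two_neq0 three_neq0.
have [->|a1] := eqVneq a 1; last by exists 1; rewrite ?oner_neq0 // expr1n mul1r.
by exists 2; rewrite // mulr1 -natrX -subr_eq0 -[X in _ - X]/(1%:R) -natrB.
Qed.

Section SymmetricDifference.
Variable n : nat.
Implicit Types A B C : {set 'I_n}.

Lemma in_symdiff A B i : (i \in symdiff A B) = (i \in A) (+) (i \in B).
Proof. by rewrite !inE; case: (i \in A); case: (i \in B). Qed.

Lemma symdiffC : commutative (@symdiff n).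
Proof. by move=> A B; apply/setP => i; rewrite !in_symdiff addbC. Qed.

Lemma symdiffA : associative (@symdiff n).
Proof. by move=> A B C; apply/setP => i; rewrite !in_symdiff addbA. Qed.

Lemma symdiffs0 : right_id set0 (@symdiff n).
Proof. by move=> A; apply/setP => i; rewrite in_symdiff inE addbF. Qed.

Lemma symdiff0s : left_id set0 (@symdiff n).
Proof. by move=> A; rewrite symdiffC symdiffs0. Qed.

Lemma symdiffv : self_inverse set0 (@symdiff n).
Proof. by move=> A; apply/setP => i; rewrite in_symdiff inE addbb. Qed.

Lemma symdiffKl A : involutive (symdiff A).
Proof. by move=> B; rewrite symdiffA symdiffv symdiff0s. Qed.

Lemma symdiff_eq A B C : (symdiff A B == C) = (B == symdiff A C).
Proof. by rewrite -(inv_eq (symdiffKl A)). Qed.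

Lemma symdiff_cancell A B C : symdiff (symdiff A B) (symdiff A C) = symdiff B C.
Proof. by rewrite (symdiffC A B) -symdiffA symdiffKl. Qed.

Lemma card_symdiff A B : #|symdiff A B| = (#|A :\: B| + #|B :\: A|)%N.
Proof.
rewrite cardsU; suff -> : (A :\: B) :&: (B :\: A) = set0 by rewrite cards0 subn0.
by apply/setP => i; rewrite !inE; case: (i \in A); case: (i \in B).
Qed.

Lemma odd_card_symdiff A B : odd #|symdiff A B| = odd #|A| (+) odd #|B|.
Proof.
rewrite card_symdiff -(cardsID B A) -(cardsID A B) (setIC B A) !oddD.
by do 3!case: (odd _).
Qed.

Lemma prod_symdiff (R : comPzRingType) (F : 'I_n -> R) A B :
    (forall i, F i * F i = 1) ->
  \prod_(i in symdiff A B) F i = \prod_(i in A) F i * \prod_(i in B) F i.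
Proof.
move=> FF; rewrite !(big_mkcond (fun i => i \in _)) -big_split.
apply: eq_bigr => i _; rewrite in_symdiff.
by case: (i \in A); case: (i \in B); rewrite /= ?mulr1 ?mul1r.
Qed.

End SymmetricDifference.

Section AnticommutingBlades.
Variable n : nat.
Implicit Types A B C : {set 'I_n}.

(* [e_A e_B = - e_B e_A] exactly when [anticomm A B]. *)
Definition anticomm A B : bool := odd (#|A| * #|B| + #|A :&: B|).

Lemma anticomm0s B : anticomm set0 B = false.
Proof. by rewrite /anticomm cards0 mul0n set0I cards0. Qed.

Lemma anticomms0 A : anticomm A set0 = false.
Proof. by rewrite /anticomm cards0 muln0 setI0 cards0. Qed.

Lemma anticommTs B : anticomm setT B = ~~ odd n && odd #|B|.
Proof.
by rewrite /anticomm setTI cardsT card_ord oddD oddM; case: (odd n); case: (odd _).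
Qed.

Lemma anticommsT A : anticomm A setT = ~~ odd n && odd #|A|.
Proof. by rewrite -anticommTs /anticomm mulnC setIC. Qed.

Lemma anticommU1 A B i : i \notin B ->
  anticomm A (i |: B) = anticomm A B (+) odd #|A| (+) (i \in A).
Proof.
move=> iB; have -> : anticomm A (i |: B) = odd (#|A| * #|B|.+1 + ((i \in A) + #|A :&: B|)).
  rewrite /anticomm cardsU1 iB (cardsD1 i (A :&: _)) !inE eqxx andbT.
  congr (odd (_ + (_ + _))); apply: eq_card => j; rewrite !inE.
  by case: eqVneq => [->|]; rewrite ?(negPf iB) ?andbF.
by rewrite mulnS /anticomm !oddD oddb; do 4!case: (odd _) => //; case: (i \in A).
Qed.

Lemma anticomm1 A i : anticomm A [set i] = odd #|A| (+) (i \in A).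
Proof. by rewrite -[[set i]]setU0 anticommU1 ?inE // anticomms0. Qed.

Lemma exists_anticomm1 A : A != set0 -> ~~ odd n \/ A != setT ->
  exists i, anticomm A [set i].
Proof.
move=> /set0Pn[a aA] nA; case: (boolP (odd #|A|)) => [oA|eA]; last first.
  by exists a; rewrite anticomm1 aA (negPf eA).
have : A != setT.
  by case: nA => // en; apply: contraTneq oA => ->; rewrite cardsT card_ord.
by rewrite -subTset => /subsetPn[b _ bA]; exists b; rewrite anticomm1 oA (negPf bA).
Qed.

(* Replacing an element of [B] outside [A] by one of [A] changes the parity of
   [#|A :&: B|]. *)
Lemma exists_anticomm_card m A : (0 < m < n)%N -> A != set0 -> A != setT ->
  exists2 B : {set 'I_n}, #|B| = m & anticomm A B.
Proof.
case: m => // m /andP[_ mn] /set0Pn[a aA]; rewrite -subTset => /subsetPn[b _ bA].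
have ab : a != b by apply: contraNneq bA => <-.
have [|B /subsetP sB cB] := @exists_subset_card _ (~: [set a; b]) m.
  by rewrite cardsCs setCK cards2 ab card_ord; lia.
have aB : a \notin B by apply/negP => /sB; rewrite !inE eqxx.
have bB : b \notin B by apply/negP => /sB; rewrite !inE eqxx orbT.
case Aa: (anticomm A (a |: B)); first by exists (a |: B); rewrite ?cardsU1 ?aB ?cB.
exists (b |: B); first by rewrite cardsU1 bB cB.
by move: Aa; rewrite !anticommU1 // aA (negPf bA) addbT addbF => /negbFE.
Qed.

Lemma odd_bin2_symdiff A B : odd 'C(#|symdiff A B|, 2) =
  odd 'C(#|A|, 2) (+) odd 'C(#|B|, 2) (+) anticomm A B.
Proof.
rewrite /anticomm card_symdiff -(cardsID B A) -(cardsID A B) (setIC B A).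
rewrite !bin2D !oddD !oddM !oddD.
by do 3!case: (odd #|_|); do 3!case: (odd _).
Qed.

End AnticommutingBlades.

Section StructureConstants.
Variables (K : fieldType) (n : nat) (eta : 'I_n -> K).
Implicit Types (A B C : {set 'I_n}) (U V : clif K n).

Lemma csignE A B :
  csign K A B = \prod_(a in A) \prod_(b in B) (-1) ^+ (b < a)%N.
Proof.
rewrite pair_big /csign -prodr_const big_mkcond [RHS]big_mkcond.
apply: eq_bigr => -[a b] _; rewrite /= inE /=.
by case: (a \in A); case: (b \in B); case: (b < a)%N.
Qed.

Lemma csign_symdiffl A B C :
  csign K (symdiff A B) C = csign K A C * csign K B C.
Proof.
rewrite !csignE prod_symdiff // => a; rewrite -big_split big1 // => b _.
by rewrite /= -expr2 sqrr_sign.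
Qed.

Lemma csign_symdiffr A B C :
  csign K A (symdiff B C) = csign K A B * csign K A C.
Proof.
rewrite !csignE -big_split; apply: eq_bigr => a _; rewrite prod_symdiff // => b.
by rewrite -expr2 sqrr_sign.
Qed.

Lemma prod_sign_eq A B :
  \prod_(a in A) \prod_(b in B) (-1) ^+ (a == b) = (-1) ^+ #|A :&: B| :> K.
Proof.
rewrite -prodr_const [RHS](eq_bigl _ _ (fun a => in_setI a A B)) [RHS]big_mkcondr.
apply: eq_bigr => a _; rewrite big_mkcond (bigD1 a) //= eqxx big1 ?mulr1 // => b ba.
by rewrite eq_sym (negPf ba); case: (b \in B).
Qed.

Lemma csignM_swap A B : csign K A B * csign K B A = (-1) ^+ anticomm A B.
Proof.
rewrite !csignE [X in _ * X]exchange_big -big_split signr_odd exprD mulnC exprM.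
rewrite -prod_sign_eq -prodrMl; apply: eq_bigr => a _; rewrite -prodrN -big_split.
apply: eq_bigr => b _ /=; rewrite -val_eqE /=.
by case: ltngtP; rewrite ?mulr1 ?mul1r ?opprK.
Qed.

Lemma csignC A B : csign K A B = (-1) ^+ anticomm A B * csign K B A.
Proof. by rewrite -csignM_swap -mulrA -expr2 /csign sqrr_sign mulr1. Qed.

Lemma prod_setI_cocycle A B C :
  (\prod_(i in A :&: B) eta i) * (\prod_(i in symdiff A B :&: C) eta i) =
  (\prod_(i in A :&: symdiff B C) eta i) * (\prod_(i in B :&: C) eta i).
Proof.
rewrite !(big_mkcond (fun i => i \in _)) -!big_split; apply: eq_bigr => i _.
rewrite !in_setI !in_symdiff.
by do 3!case: (i \in _); rewrite /= ?mulr1 ?mul1r.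
Qed.

(* The structure constant in [e_A e_B = blade_coef A B *: e_(symdiff A B)]. *)
Definition blade_coef A B : K := csign K A B * \prod_(i in A :&: B) eta i.

Lemma blade_coef_cocycle A B C :
  blade_coef A B * blade_coef (symdiff A B) C =
  blade_coef A (symdiff B C) * blade_coef B C.
Proof.
rewrite /blade_coef csign_symdiffl csign_symdiffr mulrACA prod_setI_cocycle.
by rewrite [RHS]mulrACA !mulrA.
Qed.

Lemma blade_coefC A B : blade_coef A B = (-1) ^+ anticomm A B * blade_coef B A.
Proof. by rewrite /blade_coef csignC -mulrA setIC. Qed.

Lemma blade_coef0s A : blade_coef set0 A = 1.
Proof. by rewrite /blade_coef csignE set0I !big_set0 mulr1. Qed.

Lemma blade_coefs0 A : blade_coef A set0 = 1.
Proof. by rewrite blade_coefC blade_coef0s anticomms0 mulr1. Qed.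

Lemma blade_coef_neq0 A B : (forall i, eta i != 0) -> blade_coef A B != 0.
Proof.
move=> eta_neq0; rewrite mulf_neq0 //; first by rewrite signr_eq0.
by rewrite prodf_seq_neq0; apply/allP => i _; rewrite eta_neq0 implybT.
Qed.

Lemma cmulE U V C : cmul eta U V C =
  \sum_A U A * V (symdiff A C) * blade_coef A (symdiff A C).
Proof.
rewrite ffunE; apply: eq_bigr => A _.
rewrite (big_pred1 (symdiff A C)) ?mulrA // => B.
by rewrite /= symdiff_eq.
Qed.

Lemma cmulA : associative (cmul eta).
Proof.
move=> U V W; apply/ffunP => D; rewrite !cmulE.
under eq_bigr => A _ do rewrite cmulE mulr_sumr mulr_suml.
under [RHS]eq_bigr => C _ do rewrite cmulE !mulr_suml.
rewrite [RHS]exchange_big; apply: eq_bigr => A _ /=.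
rewrite (reindex_inj (inv_inj (symdiffKl A))); apply: eq_bigr => C _ /=.
have := blade_coef_cocycle A (symdiff A C) (symdiff C D).
rewrite symdiffKl symdiff_cancell (symdiffC A C) symdiff_cancell.
move: (blade_coef A (symdiff C A)) (blade_coef C _) (blade_coef A (symdiff A D))
  (blade_coef (symdiff C A) _) => p q r s cocycle.
by rewrite -mulrA -[_ * s * r]mulrA (mulrC s) -cocycle -!mulrA (mulrCA (W _)).
Qed.

Lemma cmul1l : left_id (cone K n) (cmul eta).
Proof.
move=> U; apply/ffunP => C; rewrite cmulE (bigD1 set0) //= big1 => [|A A0].
  by rewrite ffunE eqxx mul1r addr0 symdiff0s blade_coef0s mulr1.
by rewrite ffunE (negPf A0) !mul0r.
Qed.

Lemma cmul1r : right_id (cone K n) (cmul eta).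
Proof.
move=> U; apply/ffunP => C; rewrite cmulE (bigD1 C) //= big1 => [|A AC].
  by rewrite ffunE symdiffv eqxx mulr1 addr0 blade_coefs0 mulr1.
by rewrite ffunE symdiff_eq symdiffs0 eq_sym (negPf AC) mulr0 mul0r.
Qed.

Lemma cmulDl : left_distributive (cmul eta) +%R.
Proof.
move=> U V W; apply/ffunP => C; rewrite [RHS]ffunE !cmulE -big_split.
by apply: eq_bigr => A _; rewrite /= ffunE !mulrDl.
Qed.

Lemma cmulDr : right_distributive (cmul eta) +%R.
Proof.
move=> U V W; apply/ffunP => C; rewrite [RHS]ffunE !cmulE -big_split.
by apply: eq_bigr => A _; rewrite /= ffunE mulrDr !mulrDl.
Qed.

Lemma cone_neq0 : cone K n != 0.
Proof. by apply/eqP => /ffunP/(_ set0)/eqP; rewrite !ffunE eqxx oner_eq0. Qed.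

End StructureConstants.

Section GradedSubspaces.
Variables (K : fieldType) (n : nat).
Implicit Types (X : clif K n) (A : {set 'I_n}).

Lemma center_grade0n X : center X -> grade0n X.
Proof. by move=> cX A A0 AT; apply: cX => //; right. Qed.

Lemma grade0n_center X : odd n -> grade0n X -> center X.
Proof. by move=> on X0 A A0 [|]; [rewrite on|exact: X0]. Qed.

Lemma grade_mod4_0_center X : (n < 4)%N -> grade_mod4 0 X -> center X.
Proof.
move=> n4 X0 A A0 _; apply: X0; rewrite modn_small -?lt0n ?card_gt0 //.
by apply: leq_ltn_trans n4; rewrite -[n in (_ <= n)%N]card_ord max_card.
Qed.

Lemma grade_mod4_grade0n k X : (n <= 4)%N -> (k == 0) || (n <= k)%N ->
  grade_mod4 k X -> grade0n X.
Proof.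
move=> n4 kn Xk A A0 AT; apply: Xk.
have := card_nonempty_proper A0 AT; rewrite card_ord => /andP[A_gt0 A_lt].
by rewrite modn_small; lia.
Qed.

Lemma grade0n_grade_mod4 X : (n %% 4)%N = 0 -> grade0n X -> grade_mod4 0 X.
Proof.
move=> n4 X0 A A4; apply: X0; apply: contraNneq A4 => ->; first by rewrite cards0.
by rewrite cardsT card_ord n4.
Qed.

End GradedSubspaces.

(* Recording [eta] in the type makes the Clifford product the canonical
   multiplication; finite functions already carry the pointwise one. *)
Definition clifford (K : fieldType) (n : nat) (eta : 'I_n -> K) : Type := clif K n.

Section CliffordAlgebra.
Variables (K : fieldType) (n : nat) (eta : 'I_n -> K).

HB.instance Definition _ := Vector.copy (clifford eta) {ffun {set 'I_n} -> K^o}.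
HB.instance Definition _ := GRing.Zmodule_isNzRing.Build (clifford eta)
  (cmulA eta) (cmul1l eta) (cmul1r eta) (cmulDl eta) (cmulDr eta) (cone_neq0 K n).

Implicit Types (U V X : clifford eta) (A B C : {set 'I_n}).

Lemma clifford_mulE U V C : (U * V) C =
  \sum_A U A * V (symdiff A C) * blade_coef eta A (symdiff A C).
Proof. exact: cmulE. Qed.

Lemma clifford_addE U V C : (U + V) C = U C + V C. Proof. exact: ffunE. Qed.
Lemma clifford_scaleE (c : K) U C : (c *: U) C = c * U C. Proof. exact: ffunE. Qed.
Lemma clifford_oneE C : (1 : clifford eta) C = (C == set0)%:R.
Proof. by rewrite ffunE; case: eqP. Qed.

Fact clifford_scaleAl (c : K) U V : c *: (U * V) = (c *: U) * V.
Proof.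
apply/ffunP => C; rewrite clifford_scaleE !clifford_mulE mulr_sumr.
by apply: eq_bigr => A _; rewrite clifford_scaleE !mulrA.
Qed.
HB.instance Definition _ :=
  GRing.Lmodule_isLalgebra.Build K (clifford eta) clifford_scaleAl.

Fact clifford_scaleAr (c : K) U V : c *: (U * V) = U * (c *: V).
Proof.
apply/ffunP => C; rewrite clifford_scaleE !clifford_mulE mulr_sumr.
by apply: eq_bigr => A _; rewrite clifford_scaleE !mulrA (mulrC c).
Qed.
HB.instance Definition _ :=
  GRing.Lalgebra_isAlgebra.Build K (clifford eta) clifford_scaleAr.
HB.instance Definition _ := Algebra_isFalgebra.Build K (clifford eta).

Lemma cunitE U : cunit eta U <-> U \is a GRing.unit.
Proof.
split=> [[V [UV VU]]|Uu]; first by apply/unitrP; exists V.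
by exists U^-1; split; [exact: (divrr Uu)|exact: (mulVr Uu)].
Qed.

Lemma clifford_mulE_r U V C : (U * V) C =
  \sum_A V A * U (symdiff A C) * blade_coef eta (symdiff A C) A.
Proof.
rewrite clifford_mulE (reindex_inj (inv_inj (symdiffKl C))); apply: eq_bigr => A _.
by rewrite [symdiff (symdiff C A) C]symdiffC symdiffKl (symdiffC C A) [U _ * _]mulrC.
Qed.

Lemma coef0_mulC U V : (U * V) set0 = (V * U) set0.
Proof.
rewrite clifford_mulE clifford_mulE_r; apply: eq_bigr => A _.
by rewrite symdiffs0 [U A * _]mulrC.
Qed.

Lemma comm_disjoint_support X U :
  (forall A B, anticomm A B -> X A = 0 \/ U B = 0) -> GRing.comm X U.
Proof.
move=> XU; apply/ffunP => C; rewrite clifford_mulE clifford_mulE_r.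
apply: eq_bigr => A _; rewrite (blade_coefC eta A); have := XU A (symdiff A C).
case: (anticomm _ _) => [/(_ isT) [] -> | _]; rewrite ?(mulr0, mul0r) //.
by rewrite mul1r.
Qed.

Definition blade B : clifford eta := [ffun A => (A == B)%:R].

Lemma bladeE B A : blade B A = (A == B)%:R. Proof. exact: ffunE. Qed.

Lemma mul_bladeE X B C :
  (X * blade B) C = X (symdiff B C) * blade_coef eta (symdiff B C) B.
Proof.
rewrite clifford_mulE_r (bigD1 B) //= big1 => [|A /negPf AB].
  by rewrite bladeE eqxx mul1r addr0.
by rewrite bladeE AB !mul0r.
Qed.

Lemma blade_mulE X B C :
  (blade B * X) C = X (symdiff B C) * blade_coef eta B (symdiff B C).
Proof.
rewrite clifford_mulE (bigD1 B) //= big1 => [|A /negPf AB].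
  by rewrite bladeE eqxx mul1r addr0.
by rewrite bladeE AB !mul0r.
Qed.

Lemma blade_sqr B : blade B * blade B = (blade_coef eta B B)%:A.
Proof.
apply/ffunP => C; rewrite mul_bladeE clifford_scaleE clifford_oneE bladeE.
rewrite symdiff_eq symdiffv.
by case: eqP => [->|_]; rewrite ?mul0r ?mulr0 // symdiffs0 mulrC.
Qed.

Lemma blade_unit B : (forall i, eta i != 0) -> blade B \is a GRing.unit.
Proof.
move=> eta_neq0; have := alg_unit (clifford eta) (blade_coef_neq0 B B eta_neq0).
by rewrite -blade_sqr unitrM_comm // andbb.
Qed.

Lemma sqr_scale_blade (c : K) A :
  (c *: blade A) ^+ 2 = (c ^+ 2 * blade_coef eta A A)%:A.
Proof. by rewrite exprZn expr2 [_ ^+ 2]expr2 blade_sqr scalerA. Qed.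

Lemma blade_add1_unit (c : K) A : c ^+ 2 * blade_coef eta A A != 1 ->
  c *: blade A + 1 \is a GRing.unit.
Proof.
rewrite -subr_eq0 => /(alg_unit (clifford eta)).
rewrite scalerBl scale1r -sqr_scale_blade subr_sqr_1 unitrM_comm => [/andP[]//|].
by apply: commrD (commr1 _); apply/commr_sym/(commrB (commr_refl _))/commr1.
Qed.

Lemma sqr_blade_add1_coef (c : K) A : A != set0 ->
  ((c *: blade A + 1) ^+ 2 : clifford eta) A = c *+ 2.
Proof.
move=> A0; rewrite sqrrD1 -scaler_nat sqr_scale_blade.
rewrite !clifford_addE !clifford_scaleE clifford_oneE bladeE (negPf A0) eqxx.
by rewrite !mulr0 add0r addr0 mulr1 mulr_natl.
Qed.

End CliffordAlgebra.

Section GradeTwist.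
Variables (K : fieldType) (n : nat) (eta : 'I_n -> K).
Implicit Types (U V : clifford eta) (A : {set 'I_n}) (s t : nat -> nat).

Definition grade_twist s U : clifford eta :=
  [ffun A : {set 'I_n} => (-1) ^+ s #|A| * U A].

Lemma grade_twistE s U A : grade_twist s U A = (-1) ^+ s #|A| * U A.
Proof. exact: ffunE. Qed.

Lemma grade_twistK s : involutive (grade_twist s).
Proof. by move=> U; apply/ffunP => A; rewrite !grade_twistE signrMK. Qed.

Lemma grade_twistC s t U :
  grade_twist s (grade_twist t U) = grade_twist t (grade_twist s U).
Proof. by apply/ffunP => A; rewrite !grade_twistE mulrCA. Qed.

Lemma grade_twist1 s : s 0 = 0 -> grade_twist s 1 = 1.
Proof.
move=> s0; apply/ffunP => A; rewrite grade_twistE clifford_oneE.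
by case: eqP => [->|_]; rewrite ?mulr0 // cards0 s0 mul1r.
Qed.

Fact grade_twist_is_linear s : linear (grade_twist s).
Proof.
move=> c U V; apply/ffunP => A.
by rewrite !(grade_twistE, clifford_addE, clifford_scaleE) mulrDr mulrCA.
Qed.
HB.instance Definition _ s := GRing.isSemilinear.Build K _ _ _ (grade_twist s)
  (GRing.semilinear_linear (grade_twist_is_linear s)).

Lemma grade_twist_eigenP s (b : bool) U : (2 : K) != 0 ->
  grade_twist s U = (-1) ^+ b *: U <->
  forall A, odd (s #|A|) != b -> U A = 0.
Proof.
move=> two_neq0; split=> [sU A sA|sU].
  move/(congr1 (fun V : clifford eta => V A)): sU.
  rewrite grade_twistE clifford_scaleE -signr_odd.
  have -> : odd (s #|A|) = ~~ b by move: sA; case: (odd _); case: b.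
  rewrite signrN mulNr => /eqP; rewrite eq_sym -addr_eq0 -mulr2n -mulr_natr.
  by rewrite !mulf_eq0 signr_eq0 (negPf two_neq0) orbF => /eqP.
apply/ffunP => A; rewrite grade_twistE clifford_scaleE -signr_odd.
by case: (eqVneq (odd (s #|A|)) b) => [->|/sU ->]; rewrite ?mulr0.
Qed.

End GradeTwist.

Section Involutions.
Variables (K : fieldType) (n : nat) (eta : 'I_n -> K).
Implicit Types (U V T : clifford eta) (A B C : {set 'I_n}).

Definition ginvol : clifford eta -> clifford eta := grade_twist id.
Definition reversion : clifford eta -> clifford eta :=
  grade_twist (fun k => 'C(k, 2)).

HB.instance Definition _ := GRing.Linear.copy ginvol (grade_twist id).
HB.instance Definition _ :=
  GRing.Linear.copy reversion (grade_twist (fun k => 'C(k, 2))).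

Lemma ginvolE U A : ginvol U A = (-1) ^+ #|A| * U A.
Proof. exact: grade_twistE. Qed.

Lemma reversionE U A : reversion U A = (-1) ^+ 'C(#|A|, 2) * U A.
Proof. exact: grade_twistE. Qed.

Lemma ginvolK : involutive ginvol. Proof. exact: grade_twistK. Qed.

Lemma reversionK : involutive reversion. Proof. exact: grade_twistK. Qed.

Lemma reversion_ginvol U : reversion (ginvol U) = ginvol (reversion U).
Proof. exact: grade_twistC. Qed.

Fact ginvol_is_monoid_morphism : monoid_morphism ginvol.
Proof.
split=> [|U V]; first exact: grade_twist1.
apply/ffunP => C; rewrite ginvolE !clifford_mulE mulr_sumr; apply: eq_bigr => A _.
rewrite !ginvolE -{1}[C](symdiffKl A) -(signr_odd _ #|symdiff _ _|).
by rewrite odd_card_symdiff signr_addb !signr_odd mulrA; congr (_ * _); rewrite mulrACA.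
Qed.
HB.instance Definition _ := GRing.isMonoidMorphism.Build (clifford eta)
  (clifford eta) ginvol ginvol_is_monoid_morphism.

Lemma ginvol_unit T : (ginvol T \is a GRing.unit) = (T \is a GRing.unit).
Proof.
by apply/idP/idP => [/(rmorph_unit ginvol)|/(rmorph_unit ginvol)//]; rewrite /= ginvolK.
Qed.

Lemma reversion1 : reversion 1 = 1. Proof. exact: grade_twist1. Qed.

Lemma reversionM U V : reversion (U * V) = reversion V * reversion U.
Proof.
apply/ffunP => C; rewrite reversionE clifford_mulE clifford_mulE_r mulr_sumr.
apply: eq_bigr => A _; rewrite !reversionE (blade_coefC eta A).
rewrite -{1}[C](symdiffKl A) -(signr_odd _ 'C(#|symdiff _ _|, 2)) odd_bin2_symdiff.
by rewrite !signr_addb !signr_odd mulrACA signrMK; congr (_ * _); rewrite mulrACA.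
Qed.

Lemma reversion_unit T : T \is a GRing.unit -> reversion T \is a GRing.unit.
Proof.
move=> Tu; apply/unitrP; exists (reversion T^-1).
by rewrite -!reversionM mulrV ?mulVr // reversion1.
Qed.

Lemma cunit_reversionM T : T \is a GRing.unit -> cunit eta (reversion T * T).
Proof. by move=> Tu; apply/cunitE; rewrite unitrMl ?reversion_unit. Qed.

Lemma reversionV T : T \is a GRing.unit -> reversion T^-1 = (reversion T)^-1.
Proof.
move=> Tu; apply: (mulrI (reversion_unit Tu)).
by rewrite -reversionM mulVr // reversion1 mulrV ?reversion_unit.
Qed.

Lemma ginvol_blade B : ginvol (blade eta B) = (-1) ^+ #|B| *: blade eta B.
Proof.
apply/ffunP => A; rewrite ginvolE clifford_scaleE bladeE.
by case: eqP => [->|_] //; rewrite !mulr0.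
Qed.

End Involutions.

Section Centralizers.
Variables (K : fieldType) (n : nat) (eta : 'I_n -> K).
Hypotheses (two_neq0 : (2 : K) != 0) (eta_neq0 : forall i, eta i != 0).
Implicit Types (U X T : clifford eta) (A B C : {set 'I_n}).

Lemma comm_blade X B :
  GRing.comm X (blade eta B) <-> forall A, anticomm A B -> X A = 0.
Proof.
split=> [XB A AB|XB]; last first.
  by apply: comm_disjoint_support => A C; rewrite bladeE;
    case: eqP => [->|]; [left; apply: XB|right].
have := congr1 (fun Y : clifford eta => Y (symdiff B A)) XB.
rewrite mul_bladeE blade_mulE symdiffKl (blade_coefC eta A) AB expr1 mulN1r mulrN.
move/eqP; rewrite eq_sym -addr_eq0 -mulr2n -mulr_natr.
rewrite mulf_eq0 (negPf two_neq0) orbF mulf_eq0.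
by rewrite (negPf (blade_coef_neq0 _ _ eta_neq0)) orbF => /eqP.
Qed.

Definition centralizes k X := forall U, grade_mod4 k U -> GRing.comm X U.

Lemma centralizesP k X : centralizes k X <->
  forall A B, (#|B| %% 4)%N = k -> anticomm A B -> X A = 0.
Proof.
split=> [Xk A B Bk AB|Xk U Uk].
  suff /Xk/comm_blade/(_ A AB) : grade_mod4 k (blade eta B) by [].
  by move=> C; rewrite bladeE; case: (eqVneq C B) => [->|//]; rewrite Bk eqxx.
apply: comm_disjoint_support => A B AB.
have [/eqP Bk|/Uk] := boolP (#|B| %% 4 == k)%N; last by right.
by left; apply: Xk AB.
Qed.

Lemma anticomm_center X A B : center X -> anticomm A B -> X A = 0.
Proof.
move=> cX AB; apply: cX; first by apply: contraTneq AB => ->; rewrite anticomm0s.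
case: (boolP (odd n)) => on; [right|by left].
by apply: contraTneq AB => ->; rewrite anticommTs on.
Qed.

Lemma center_comm X U : center X -> GRing.comm X U.
Proof.
by move=> cX; apply: comm_disjoint_support => A B /(anticomm_center cX); left.
Qed.

Lemma centerP X : center X <-> forall U, GRing.comm X U.
Proof.
split=> [cX U|XC A A0 AT]; first exact: center_comm.
by have [i Ai] := exists_anticomm1 A0 AT; apply: ((comm_blade X _).1 _ _ Ai).
Qed.

Lemma centralizes_center k X : odd k -> (k < 4)%N -> (k < n)%N ->
  centralizes k X <-> center X.
Proof.
move=> ok k4 kn; split=> [/centralizesP Xk A A0 AT|cX U _]; last exact: center_comm.
have [A_T|A_T] := eqVneq A setT; last first.
  have [|B cB AB] := @exists_anticomm_card _ k A _ A0 A_T.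
    by rewrite kn andbT odd_gt0.
  by apply: Xk AB; rewrite cB modn_small.
have [|B _ cB] := @exists_subset_card _ [set: 'I_n] k.
  by rewrite cardsT card_ord ltnW.
apply: (Xk _ B); first by rewrite cB modn_small.
by case: AT => [en|]; rewrite A_T ?eqxx // anticommTs en cB.
Qed.

Lemma grade0n_centralizes k X : ~~ odd k -> grade0n X -> centralizes k X.
Proof.
move=> ek X0; apply/centralizesP => A B Bk AB; apply: X0.
  by apply: contraTneq AB => ->; rewrite anticomm0s.
apply: contraTneq AB => ->; rewrite anticommTs.
by rewrite -(odd_mod #|B| (d := 4)) // Bk (negPf ek) andbF.
Qed.

Lemma centralizes_grade0n m X : ~~ odd m -> (0 < m < n)%N ->
  centralizes (m %% 4)%N X <-> grade0n X.
Proof.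
move=> em mn; split=> [/centralizesP Xk A A0 AT|]; last first.
  by apply: grade0n_centralizes; rewrite odd_mod.
by have [B cB AB] := exists_anticomm_card mn A0 AT; apply: Xk AB; rewrite cB.
Qed.

Lemma centralizes2_grade0n X : (1 < n)%N -> centralizes 2 X <-> grade0n X.
Proof.
rewrite leq_eqVlt => /orP[/eqP n2|]; last exact: (@centralizes_grade0n 2).
split=> [/centralizesP X2 A A0 AT|]; last exact: grade0n_centralizes.
apply: (X2 A setT); first by rewrite cardsT card_ord -n2.
have := card_nonempty_proper A0 AT; rewrite anticommsT card_ord.
by case: #|A| => [|[|m]] //; rewrite -n2.
Qed.

Lemma grade_mod4P k U : (k < 4)%N -> grade_mod4 k U <->
  reversion U = (-1) ^+ 'C(k, 2) *: U /\ ginvol U = (-1) ^+ k *: U.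
Proof.
move=> k4; rewrite -(signr_odd _ 'C(k, 2)) -(signr_odd _ k) !grade_twist_eigenP //.
split=> [Uk|[U2 U1] A].
  by split=> A /negPf kA; apply: Uk; rewrite modn4_eq // kA ?andbF.
by rewrite modn4_eq // negb_and => /orP[/U2|/U1].
Qed.

Lemma conj_grade_mod4 k T U : (k < 4)%N -> T \is a GRing.unit -> grade_mod4 k U ->
  grade_mod4 k (T * U / T) <->
  GRing.comm (reversion T * T) U /\ GRing.comm (T^-1 * ginvol T) U.
Proof.
move=> k4 Tu /(grade_mod4P _ k4)[revU ginvU].
have RVu : (reversion T)^-1 \is a GRing.unit by rewrite unitrV reversion_unit.
have GTu : ginvol T \is a GRing.unit by rewrite ginvol_unit.
rewrite -{1}[reversion T]invrK -eq_conj_comm // -eq_conj_comm // invrK.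
rewrite grade_mod4P // !reversionM reversionV // !rmorphM rmorphV //= revU ginvU.
rewrite -!(scalerAl, scalerAr) mulrA.
have sign_neq0 m : (-1) ^+ m != 0 :> K by rewrite signr_eq0.
by split=> [[/(scalerI (sign_neq0 _)) -> /(scalerI (sign_neq0 _)) ->]|[-> ->]].
Qed.

Lemma GammaE k T : Gamma eta k T <->
  T \is a GRing.unit /\ forall U, grade_mod4 k U -> grade_mod4 k (T * U / T).
Proof.
split=> [[/cunitE Tu pT]|[Tu pT]]; first split=> // U.
  by apply: pT; [exact: (divrr Tu)|exact: (mulVr Tu)].
split=> [|Ti TTi _ U Uk]; first exact/cunitE.
have -> : Ti = T^-1 by apply: (mulrI Tu); rewrite (divrr Tu).
exact: pT.
Qed.

Lemma GammaP k T : (k < 4)%N -> Gamma eta k T <->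
  [/\ T \is a GRing.unit, centralizes k (reversion T * T)
    & centralizes k (T^-1 * ginvol T)].
Proof.
move=> k4; rewrite GammaE; split=> [[Tu pT]|[Tu cR cG]].
  by split=> // U Uk; have [] := (conj_grade_mod4 k4 Tu Uk).1 (pT U Uk).
by split=> // U Uk; apply/conj_grade_mod4 => //; split; [apply: cR|apply: cG].
Qed.

Lemma Gamma1_sub k T : (1 < n)%N -> (k < 4)%N -> Gamma eta 1 T -> Gamma eta k T.
Proof.
move=> n1 k4 /GammaP[//|Tu /centralizes_center cR /centralizes_center cG].
by apply/GammaP => //; split=> // U _; apply: center_comm; [apply: cR|apply: cG].
Qed.

Lemma Gamma_trivial k T : (forall U, grade_mod4 k U -> center U) ->
  Gamma eta k T <-> T \is a GRing.unit.
Proof.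
move=> kc; rewrite GammaE; split=> [[]|Tu] //; split=> // U Uk.
by rewrite -(center_comm T (kc U Uk)) mulrK.
Qed.

End Centralizers.

Section CenterAndPseudoscalar.
Variables (K : fieldType) (n : nat) (eta : 'I_n -> K).
Hypotheses (two_neq0 : (2 : K) != 0) (eta_neq0 : forall i, eta i != 0).
Implicit Types U X S T W : clifford eta.

Local Notation omega := (blade eta setT).

Lemma center1 : center (1 : clifford eta).
Proof. by move=> A A0 _; rewrite clifford_oneE (negPf A0). Qed.

Lemma centerD W X : center W -> center X -> center (W + X).
Proof. by move=> cW cX A A0 AT; rewrite clifford_addE cW // cX // addr0. Qed.

Lemma centerM W X : center W -> center X -> center (W * X).
Proof.
move=> cW cX; apply/(centerP two_neq0 eta_neq0) => U.
by apply/commr_sym/commrM; apply/commr_sym/center_comm.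
Qed.

Lemma centerZ (c : K) W : center W -> center (c *: W).
Proof. by move=> cW A A0 AT; rewrite clifford_scaleE cW // mulr0. Qed.

Lemma center_grade_twist s W : center W -> center (grade_twist s W).
Proof. by move=> cW A A0 AT; rewrite grade_twistE cW // mulr0. Qed.

Lemma centerV W : center W -> center (W^-1).
Proof.
move=> cW; apply/(centerP two_neq0 eta_neq0) => U.
by apply/commr_sym/commrV/commr_sym/center_comm.
Qed.

Lemma setT_neq0 : (0 < n)%N -> [set: 'I_n] != set0.
Proof. by rewrite -card_gt0 cardsT card_ord. Qed.

Lemma grade0nM X U : grade0n X -> grade0n U -> grade0n (X * U).
Proof.
move=> X0 U0 C C0 CT; rewrite clifford_mulE big1 // => A _.
have [->|A0] := eqVneq A set0; first by rewrite symdiff0s (U0 C) // mulr0 mul0r.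
have [->|AT] := eqVneq A setT; last by rewrite X0 // !mul0r.
by rewrite (U0 (symdiff _ C)) ?mulr0 ?mul0r // symdiff_eq ?symdiffs0 ?symdiffv.
Qed.

Lemma grade0n_pseudoscalar : grade0n omega.
Proof. by move=> A _ AT; rewrite bladeE (negPf AT). Qed.

Lemma grade0n_span (a b : K) : grade0n (a%:A + b *: omega).
Proof.
move=> A A0 AT; rewrite clifford_addE !clifford_scaleE clifford_oneE bladeE.
by rewrite (negPf A0) (negPf AT) !mulr0 addr0.
Qed.

Lemma grade0nE X : (0 < n)%N -> grade0n X ->
  X = (X set0)%:A + X setT *: omega.
Proof.
move=> /setT_neq0 T0 X0; apply/ffunP => A.
rewrite clifford_addE !clifford_scaleE clifford_oneE bladeE.
have [->|A0] := eqVneq A set0; first by rewrite eq_sym (negPf T0) mulr1 mulr0 addr0.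
have [->|AT] := eqVneq A setT; first by rewrite mulr1 mulr0 add0r.
by rewrite !mulr0 addr0 X0.
Qed.

Lemma pseudoscalar_comm_even T : ~~ odd n -> omega * T = ginvol T * omega.
Proof.
move=> en; apply/ffunP => C; rewrite blade_mulE mul_bladeE ginvolE.
by rewrite blade_coefC anticommTs en signr_odd mulrCA mulrA.
Qed.

(* The coefficient of [1] is invariant under conjugation, so a conjugate of
   [omega] lying in C^0 + C^n is [b *: omega] with [b ^ 2 = 1]. *)
Lemma conj_pseudoscalar_parity T : ~~ odd n -> (0 < n)%N -> T \is a GRing.unit ->
  grade0n (T * omega / T) -> exists b : bool, ginvol T = (-1) ^+ b *: T.
Proof.
move=> en n0 Tu /(grade0nE n0) conjE.
have no_scalar : (T * omega / T) set0 = 0.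
  by rewrite coef0_mulC mulKr // bladeE eq_sym (negPf (setT_neq0 n0)).
rewrite no_scalar scale0r add0r in conjE; set b := (X in X *: _) in conjE.
have b2 : b ^+ 2 == 1.
  have : (T * omega / T) * (T * omega / T) = omega * omega.
    by rewrite !mulrA mulrVK // -(mulrA T) blade_sqr mulr_algr -scalerAl mulrV.
  rewrite conjE -scalerAl -scalerAr !scalerA -expr2 blade_sqr scalerA.
  move/(congr1 (fun Y : clifford eta => Y set0)).
  rewrite !clifford_scaleE clifford_oneE eqxx !mulr1 -[RHS]mul1r.
  by move/(mulIf (blade_coef_neq0 _ _ eta_neq0)) ->.
have ginvolT : ginvol T = b *: T.
  apply: (mulrI (blade_unit setT eta_neq0)); rewrite pseudoscalar_comm_even // ginvolK.
  by rewrite -[T * omega](mulrVK Tu) conjE -scalerAl scalerAr.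
move: b2; rewrite sqrf_eq1 ginvolT => /orP[]/eqP ->; first by exists false.
by exists true.
Qed.

Lemma unit_of_norm_neq0 W (c : K) :
  center W -> c != 0 -> W * ginvol W = c%:A -> W \is a GRing.unit.
Proof.
move=> cW /(alg_unit (clifford eta)) cu normW; move: cu; rewrite -normW unitrM_comm.
  by case/andP.
exact: center_comm.
Qed.

(* The norms of [1 + S] and [1 - S] are [2 + 2 a] and [2 - 2 a], where [a] is the
   scalar part of [S]; they cannot both vanish. *)
Lemma norm1_exists_unit_add_sign S : odd n -> center S -> S * ginvol S = 1 ->
  exists b : bool, 1 + (-1) ^+ b *: S \is a GRing.unit.
Proof.
move=> on cS normS; set a := S set0.
have trace : S + ginvol S = (a *+ 2)%:A.
  rewrite (grade0nE (odd_gt0 on) (center_grade0n cS)) -/a linearD !linearZ /= rmorph1.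
  rewrite ginvol_blade cardsT card_ord -signr_odd on scaleN1r scalerN addrACA subrr.
  by rewrite addr0 -scalerDl.
have center_1p b : center (1 + (-1) ^+ b *: S).
  exact: centerD center1 (centerZ _ cS).
have norm b : (1 + (-1) ^+ b *: S) * ginvol (1 + (-1) ^+ b *: S) =
    ((1 + (-1) ^+ b * a) *+ 2)%:A.
  rewrite linearD linearZ /= rmorph1 mulrDl mul1r mulrDr mulr1 -scalerAl -scalerAr.
  rewrite normS scalerA -expr2 sqrr_sign scale1r (addrC (_ *: S)) addrACA.
  rewrite -scalerDr (addrC (ginvol S)) trace scalerA -mulr2n -scaler_nat -scalerDl.
  by rewrite mulrnAr mulrnDl.
have norm_neq0 c : c != 0 -> c *+ 2 != 0 :> K by move=> c0; rewrite -mulr_natr mulf_neq0.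
have [a1|a1] := eqVneq (1 + a) 0; [exists true|exists false];
  apply: unit_of_norm_neq0 (norm _) => //; apply: norm_neq0.
  by rewrite mulN1r; move/eqP: a1; rewrite addrC addr_eq0 => /eqP ->; rewrite opprK.
by rewrite mul1r.
Qed.

End CenterAndPseudoscalar.

Section GammaPQ.
Variables (K : fieldType) (n : nat) (eta : 'I_n -> K).
Hypotheses (two_neq0 : (2 : K) != 0) (eta_neq0 : forall i, eta i != 0).
Hypothesis (n_gt0 : (0 < n)%N).
Implicit Types U T W E : clifford eta.

Local Notation omega := (blade eta setT).

Lemma even_partP T : even_part T <-> ginvol T = T.
Proof.
have := grade_twist_eigenP id false T two_neq0; rewrite scale1r => gT.
split=> [eT|/gT eT A oA]; last by apply: eT; rewrite oA.
by apply/gT => A; rewrite eqbF_neg negbK; apply: eT.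
Qed.

Lemma odd_partP T : odd_part T <-> ginvol T = - T.
Proof.
have := grade_twist_eigenP id true T two_neq0; rewrite scaleN1r => gT.
split=> [oT|/gT oT A oA]; last by apply: oT; rewrite eqb_id.
by apply/gT => A; rewrite eqb_id; apply: oT.
Qed.

Lemma evenodd_unitsP T : evenodd_units eta T <->
  T \is a GRing.unit /\ exists b : bool, ginvol T = (-1) ^+ b *: T.
Proof.
split=> [[] [pT /cunitE Tu]|[/cunitE Tu [[]]]].
- by split=> //; exists false; rewrite scale1r; apply/even_partP.
- by split=> //; exists true; rewrite scaleN1r; apply/odd_partP.
- by rewrite scaleN1r => /odd_partP; right.
- by rewrite scale1r => /even_partP; left.
Qed.

Lemma PgrpP T : Pgrp eta T <-> exists W E,
  [/\ center W, W \is a GRing.unit, evenodd_units eta E & T = W * E].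
Proof.
split=> [[W [E [[cW /cunitE Wu] [uE ->]]]]|[W [E [cW /cunitE Wu uE ->]]]].
  by exists W, E.
by exists W, E.
Qed.

Lemma evenodd_units_Pgrp T : evenodd_units eta T -> Pgrp eta T.
Proof.
by move=> uT; apply/PgrpP; exists 1, T; rewrite mul1r unitr1; split=> //; apply: center1.
Qed.

Lemma Pgrp_center T : Pgrp eta T ->
  T \is a GRing.unit /\ center (T^-1 * ginvol T).
Proof.
move=> /PgrpP[W [E [cW Wu /evenodd_unitsP[Eu [b gE]] ->]]].
split; first by rewrite unitrMl.
have cgW : center (ginvol W) by apply: center_grade_twist.
rewrite rmorphM /= gE -!scalerAr (center_comm _ cgW) mulrA invrM // -(mulrA E^-1).
rewrite (center_comm E (centerV two_neq0 eta_neq0 cW)) mulKr //.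
by apply/centerZ/centerM => //; apply: centerV.
Qed.

Lemma QgrpE T : Qgrp eta T <-> Pgrp eta T /\ center (reversion T * T).
Proof.
split=> [[PT [cR _]]|[PT cR]] //; split=> //; split=> //.
by have [Tu _] := Pgrp_center PT; apply: cunit_reversionM.
Qed.

Lemma Q'grpE T : Q'grp eta T <-> Pgrp eta T /\ grade0n (reversion T * T).
Proof.
split=> [[PT [R0 _]]|[PT R0]] //; split=> //; split=> //.
by have [Tu _] := Pgrp_center PT; apply: cunit_reversionM.
Qed.

Lemma even_dim_evenodd_units T : ~~ odd n -> T \is a GRing.unit ->
  grade0n (T^-1 * ginvol T) -> evenodd_units eta T.
Proof.
move=> en Tu S0; apply/evenodd_unitsP; split=> //.
have [||b] := @conj_pseudoscalar_parity _ _ _ eta_neq0 T^-1 en n_gt0.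
- by rewrite unitrV.
- rewrite invrK -mulrA pseudoscalar_comm_even // mulrA.
  by apply: grade0nM => //; apply: grade0n_pseudoscalar.
rewrite rmorphV //= => gTV; exists b; apply: invr_inj; rewrite gTV.
by case: b {gTV}; rewrite ?scaleN1r ?invrN ?scale1r.
Qed.

(* Hilbert 90 for the involution of the center: the even and the odd part of
   [T] are [T * (1 + S) / 2] and [T * (1 - S) / 2] with [S = T^-1 * ginvol T]
   central, and one of the two factors is invertible. *)
Lemma odd_dim_center_Pgrp T : odd n -> T \is a GRing.unit ->
  center (T^-1 * ginvol T) -> Pgrp eta T.
Proof.
move=> on Tu cS; have gTu : ginvol T \is a GRing.unit by rewrite ginvol_unit.
have [|b] := norm1_exists_unit_add_sign two_neq0 on cS.
  by rewrite rmorphM rmorphV //= ginvolK mulrA mulrK // mulVr.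
set V := 1 + _ => Vu.
have cV : center V by apply: centerD (center1 _) (centerZ _ cS).
have TV : T * V = T + (-1) ^+ b *: ginvol T.
  by rewrite mulrDr mulr1 -scalerAr mulVKr.
apply/PgrpP; exists V^-1, (T * V); split.
- exact: centerV.
- by rewrite unitrV.
- apply/evenodd_unitsP; split; first by rewrite unitrMl.
  exists b; rewrite TV linearD linearZ /= ginvolK scalerDr scalerA -expr2 sqrr_sign.
  by rewrite scale1r addrC.
- by rewrite -(center_comm T cV) mulKr.
Qed.

Lemma PgrpE T : Pgrp eta T <-> T \is a GRing.unit /\ grade0n (T^-1 * ginvol T).
Proof.
split=> [/Pgrp_center[Tu /center_grade0n]|[Tu S0]] //.
case: (boolP (odd n)) => [on|en].
  by apply: odd_dim_center_Pgrp => //; apply: grade0n_center.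
by apply: evenodd_units_Pgrp; apply: even_dim_evenodd_units.
Qed.

Lemma Pgrp_even_dim T : ~~ odd n -> Pgrp eta T <-> evenodd_units eta T.
Proof.
move=> en; split=> [/PgrpE[Tu S0]|]; last exact: evenodd_units_Pgrp.
exact: even_dim_evenodd_units.
Qed.

Lemma Pgrp_odd_dim T : odd n -> Pgrp eta T <-> Zeven_units eta T.
Proof.
move=> on; split=> [/PgrpP[W [E [cW Wu eoE ->]]]|[W [E [uW [uE ->]]]]]; last first.
  by exists W, E; split=> //; split=> //; left.
have /cunitE WU := Wu; case: eoE => [eE|[oE Eu]]; first by exists W, E.
have co : center omega by apply: grade0n_center on _; apply: grade0n_pseudoscalar.
have ou := blade_unit setT eta_neq0.
have WE : W * E = (W * omega) * (omega^-1 * E) by rewrite mulrA mulrK.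
exists (W * omega), (omega^-1 * E); split; last split=> //.
  by split; [apply: centerM|apply/cunitE; rewrite unitrMl].
split; last by apply/cunitE; rewrite unitrMr ?unitrV //; apply/cunitE.
apply/even_partP; rewrite rmorphM rmorphV //= ginvol_blade cardsT card_ord.
by rewrite -signr_odd on scaleN1r ((odd_partP E).1 oE) invrN mulrNN.
Qed.

Lemma Gamma_centralizer k (D : clifford eta -> Prop) T : (k < 4)%N ->
  (forall X, center X -> D X) -> (forall X, D X -> grade0n X) ->
  (forall X, centralizes k X <-> D X) ->
  Gamma eta k T <-> Pgrp eta T /\ D (reversion T * T).
Proof.
move=> k4 cD D0 kD; rewrite GammaP //; split=> [[Tu /kD DR /kD DG]|[PT DR]].
  by split=> //; apply/PgrpE; split=> //; apply: D0.
by have [Tu cG] := Pgrp_center PT; split=> //; apply/kD => //; apply: cD.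
Qed.

Lemma Gamma_odd_Qgrp k T : odd k -> (k < 4)%N -> (k < n)%N ->
  Gamma eta k T <-> Qgrp eta T.
Proof.
move=> ok k4 kn; rewrite QgrpE; apply: Gamma_centralizer => // X.
  exact: center_grade0n.
exact: centralizes_center.
Qed.

Lemma Gamma_even_Q'grp m T : ~~ odd m -> (0 < m < n)%N ->
  Gamma eta (m %% 4) T <-> Q'grp eta T.
Proof.
move=> em mn; rewrite Q'grpE; apply: Gamma_centralizer; rewrite ?ltn_pmod // => X.
  exact: center_grade0n.
exact: centralizes_grade0n.
Qed.

Lemma Gamma2_Q'grp T : (1 < n)%N -> Gamma eta 2 T <-> Q'grp eta T.
Proof.
move=> n1; rewrite Q'grpE; apply: Gamma_centralizer => // X.
  exact: center_grade0n.
exact: centralizes2_grade0n.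
Qed.

Lemma reversion_mul_grade_mod4 E :
  evenodd_units eta E -> grade_mod4 0 (reversion E * E).
Proof.
move=> /evenodd_unitsP[_ [b gE]]; apply/grade_mod4P => //; rewrite !scale1r.
rewrite reversionM reversionK rmorphM /= -reversion_ginvol gE linearZ /=.
by rewrite -scalerAl -scalerAr scalerA -expr2 sqrr_sign scale1r.
Qed.

Lemma Q'grp_Qgrp T : (n %% 4)%N <> 0%N -> Q'grp eta T <-> Qgrp eta T.
Proof.
move=> n4; rewrite QgrpE Q'grpE; split=> -[PT RT]; split=> //; last exact: center_grade0n.
case: (boolP (odd n)) => [on|en]; first exact: grade0n_center.
have /reversion_mul_grade_mod4 R4 := (Pgrp_even_dim T en).1 PT.
move=> A A0 _; have [->|AT] := eqVneq A setT; last exact: RT.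
by apply: R4; rewrite cardsT card_ord; apply/eqP.
Qed.

Lemma Pgrp_Qgrp T : (n < 4)%N -> Pgrp eta T <-> Qgrp eta T.
Proof.
move=> n4; rewrite QgrpE; split=> [PT|[]//]; split=> //.
have /PgrpP[W [E [cW _ uE ->]]] := PT.
have cRW : center (reversion W) by apply: center_grade_twist.
rewrite reversionM -(center_comm (reversion E) cRW) -mulrA (mulrA (reversion E)).
rewrite -(center_comm (reversion E) cW) -mulrA.
do 2![apply: centerM => //].
by apply: grade_mod4_0_center => //; apply: reversion_mul_grade_mod4.
Qed.

(* In dimension 4 the centralizer of [C^0 + C^4] is the whole even part, so
   parity is read off the conjugate of the pseudoscalar instead. *)
Lemma Gamma0_dim4 T : n = 4 -> Gamma eta 0 T <-> Q'grp eta T.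
Proof.
move=> n4; have en : ~~ odd n by rewrite n4.
have C0_grade0n U : grade_mod4 0 U -> grade0n U.
  by apply: grade_mod4_grade0n; rewrite n4.
have grade0n_C0 U : grade0n U -> grade_mod4 0 U.
  by apply: grade0n_grade_mod4; rewrite n4.
rewrite GammaE Q'grpE Pgrp_even_dim //.
split=> [[Tu pT]|[/evenodd_unitsP[Tu [b gT]] _]].
  have uT : evenodd_units eta T.
    apply/evenodd_unitsP; split=> //; apply: conj_pseudoscalar_parity => //.
    exact/C0_grade0n/pT/grade0n_C0/grade0n_pseudoscalar.
  by split=> //; apply/C0_grade0n/reversion_mul_grade_mod4.
have conj_omega : T * omega / T = (-1) ^+ b *: omega.
  by rewrite -{1}(signrZK b T) -gT -!scalerAl -pseudoscalar_comm_even // mulrK.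
split=> // U /C0_grade0n/(grade0nE n_gt0) ->; apply: grade0n_C0.
rewrite mulrDr mulrDl mulr_algr -scalerAl mulrV // -scalerAr -scalerAl conj_omega.
by rewrite scalerA; apply: grade0n_span.
Qed.

Hypothesis three_neq0 : (3 : K) != 0.

Lemma exists_unit_not_Pgrp : (1 < n)%N ->
  exists2 T : clifford eta, T \is a GRing.unit & ~ Pgrp eta T.
Proof.
move=> n_gt1; pose A := [set Ordinal n_gt0].
have A0 : A != set0 by rewrite -card_gt0 cards1.
have AT : A != setT.
  by rewrite eqEcard subsetT cards1 cardsT card_ord -ltnNge.
have [c c0 cA] := exists_sqr_mul_neq1 (blade_coef eta A A) two_neq0 three_neq0.
have Tu := blade_add1_unit cA; exists (c *: blade eta A + 1) => // /Pgrp_center[_].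
set x := c *: _ in Tu *; set S := _^-1 * _ => cS.
have gT : ginvol (x + 1) = 1 - x.
  by rewrite linearD linearZ /= ginvol_blade cards1 expr1 scaleN1r scalerN rmorph1 addrC.
have gTS : 1 - x = (x + 1) * S by rewrite -gT mulVKr.
have : (- c *: blade eta A + 1) ^+ 2 = (1 - c ^+ 2 * blade_coef eta A A) *: S.
  rewrite scaleNr -/x addrC expr2 {2}gTS mulrA -[1 - x]opprB mulNr -subr_sqr_1 opprB.
  by rewrite sqr_scale_blade scalerBl scale1r mulrBl mul1r mulr_algl.
move/(congr1 (fun Y : clifford eta => Y A)).
rewrite sqr_blade_add1_coef // clifford_scaleE cS ?mulr0; [|by []|by right].
by move/eqP; rewrite -mulr_natr mulf_eq0 oppr_eq0 (negPf c0) (negPf two_neq0).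
Qed.

Lemma Qgrp_neq_Q'grp : (n %% 4)%N = 0%N -> ~ seteq (Qgrp eta) (Q'grp eta).
Proof.
move=> n4 QQ'; have en : ~~ odd n by rewrite -(odd_mod n (d := 4)) // n4.
have [c c0 cT] := exists_sqr_mul_neq1 (blade_coef eta setT setT) two_neq0 three_neq0.
have Tu := blade_add1_unit cT; set T := _ + 1 in Tu.
have T0 : grade0n T by rewrite /T addrC -(scale1r 1); apply: grade0n_span.
have [revT gT] := (grade_mod4P two_neq0 T (ltn0Sn 3)).1 (grade0n_grade_mod4 n4 T0).
have revTT : reversion T * T = T ^+ 2 by rewrite revT scale1r.
have PT : Pgrp eta T by apply/Pgrp_even_dim/evenodd_unitsP => //; split=> //; exists false.
have /QQ'/QgrpE[_] : Q'grp eta T.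
  by apply/Q'grpE; rewrite revTT; split=> //; apply: grade0nM.
rewrite revTT => /(_ _ (setT_neq0 n_gt0) (or_introl en)).
rewrite sqr_blade_add1_coef ?setT_neq0 // => /eqP.
by rewrite -mulr_natr mulf_eq0 (negPf c0) (negPf two_neq0).
Qed.

Lemma Gamma0_Q'grp T : (4 <= n)%N -> Gamma eta 0 T <-> Q'grp eta T.
Proof.
rewrite leq_eqVlt => /orP[/eqP/esym|]; first exact: Gamma0_dim4.
exact: (@Gamma_even_Q'grp 4).
Qed.

Lemma Gamma_groups_dim_0mod4 : (4 <= n)%N -> (n %% 4)%N = 0%N ->
  [/\ seteq (Qgrp eta) (Gamma eta 1), seteq (Qgrp eta) (Gamma eta 3),
      seteq (Q'grp eta) (Gamma eta 0), seteq (Q'grp eta) (Gamma eta 2)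
    & ~ seteq (Qgrp eta) (Q'grp eta)].
Proof.
move=> n4 nm; split=> [T|T|T|T|]; last exact: Qgrp_neq_Q'grp.
- by rewrite Gamma_odd_Qgrp //; lia.
- by rewrite Gamma_odd_Qgrp.
- by rewrite Gamma0_Q'grp.
- by rewrite Gamma2_Q'grp //; lia.
Qed.

Lemma Gamma_Qgrp_dim_not0mod4 : (4 <= n)%N -> (n %% 4)%N <> 0%N ->
  [/\ seteq (Qgrp eta) (Gamma eta 0), seteq (Qgrp eta) (Gamma eta 1),
      seteq (Qgrp eta) (Gamma eta 2) & seteq (Qgrp eta) (Gamma eta 3)].
Proof.
move=> n4 nm; split=> T.
- by rewrite Gamma0_Q'grp // Q'grp_Qgrp.
- by rewrite Gamma_odd_Qgrp //; lia.
- by rewrite Gamma2_Q'grp ?Q'grp_Qgrp //; lia.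
- by rewrite Gamma_odd_Qgrp.
Qed.

Lemma Gamma_Pgrp_dim_lt4 : (1 < n < 4)%N ->
  [/\ seteq (Gamma eta 0) (cunit eta), seteq (Gamma eta 1) (Pgrp eta),
      seteq (Gamma eta 2) (Pgrp eta), seteq (Qgrp eta) (Pgrp eta)
    & ~ seteq (Pgrp eta) (cunit eta)].
Proof.
move=> /andP[n_gt1 n4]; split=> [T|T|T|T|].
- by rewrite cunitE Gamma_trivial // => U; apply: grade_mod4_0_center.
- by rewrite Gamma_odd_Qgrp // -Pgrp_Qgrp.
- by rewrite Gamma2_Q'grp // Q'grp_Qgrp ?Pgrp_Qgrp //; lia.
- by rewrite -Pgrp_Qgrp.
- move=> PC; have [T Tu] := exists_unit_not_Pgrp n_gt1.
  by apply; apply/PC/cunitE.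
Qed.

Lemma Gamma_groups_dim2 : n = 2 ->
  [/\ seteq (Gamma eta 0) (cunit eta),
      [/\ seteq (Gamma eta 1) (evenodd_units eta),
          seteq (Gamma eta 2) (evenodd_units eta),
          seteq (Qgrp eta) (evenodd_units eta) & seteq (Pgrp eta) (evenodd_units eta)]
    & ~ seteq (evenodd_units eta) (cunit eta)].
Proof.
move=> n2; have [|G0 G1 G2 QP PC] := Gamma_Pgrp_dim_lt4; first by rewrite n2.
have PE T : Pgrp eta T <-> evenodd_units eta T by apply: Pgrp_even_dim; rewrite n2.
split=> //; first by split=> T; rewrite -?PE.
by move=> EC; apply: PC => T; rewrite PE.
Qed.

Lemma Gamma_groups_dim3 : n = 3 ->
  [/\ seteq (Gamma eta 0) (cunit eta), seteq (Gamma eta 3) (cunit eta),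
      [/\ seteq (Gamma eta 1) (Zeven_units eta), seteq (Gamma eta 2) (Zeven_units eta),
          seteq (Qgrp eta) (Zeven_units eta) & seteq (Pgrp eta) (Zeven_units eta)]
    & ~ seteq (Zeven_units eta) (cunit eta)].
Proof.
move=> n3; have [|G0 G1 G2 QP PC] := Gamma_Pgrp_dim_lt4; first by rewrite n3.
have on : odd n by rewrite n3.
have PE T : Pgrp eta T <-> Zeven_units eta T by apply: Pgrp_odd_dim.
split=> // [T||]; last by move=> EC; apply: PC => T; rewrite PE.
  rewrite cunitE Gamma_trivial // => U U3; apply: grade0n_center => //.
  by apply: grade_mod4_grade0n U3; rewrite n3.
by split=> T; rewrite -?PE.
Qed.

Lemma Gamma1_Qgrp_preserves_all : (2 <= n)%N ->
  [/\ forall k, (k < 4)%N -> Defs.subset (Gamma eta 1) (Gamma eta k),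
      seteq (Gamma eta 1) (Qgrp eta)
    & seteq (Qgrp eta)
        (fun T => cunit eta T /\ forall k, (k < 4)%N -> preserves eta k T)].
Proof.
move=> n_gt1; have G1Q T : Gamma eta 1 T <-> Qgrp eta T by apply: Gamma_odd_Qgrp.
split=> [k k4 T||T] //; first exact: Gamma1_sub.
rewrite -G1Q; split=> [G1|[Tu pT]]; last by split=> //; apply: pT.
split=> [|k k4]; first by case: G1.
by have [] := Gamma1_sub two_neq0 eta_neq0 n_gt1 k4 G1.
Qed.

End GammaPQ.

Lemma Theorem11_field (K : fieldType) (n : nat) (eta : 'I_n -> K) :
    (2 : K) != 0 -> (3 : K) != 0 -> (forall i, eta i != 0) -> (1 < n)%N ->
  Theorem11_for eta.
Proof.
move=> two_neq0 three_neq0 eta_neq0 /ltnW n_gt0; split.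
- exact: Gamma_groups_dim_0mod4.
- exact: Gamma_Qgrp_dim_not0mod4.
- exact: Gamma_groups_dim2.
- exact: Gamma_groups_dim3.
- exact: Gamma1_Qgrp_preserves_all.
Qed.

Theorem mainTheorem11 :
  (forall (R : realType) (p q : nat), (2 <= p + q)%N ->
     Theorem11_for (@eta_pq R p q)) /\
  (forall (R : realType) (n : nat), (2 <= n)%N ->
     Theorem11_for (@eta_C R n)).
Proof.
split=> [R p q|R n]; apply: Theorem11_field; rewrite ?pnatr_eq0 // => i.
  by rewrite /eta_pq; case: ifP; rewrite ?oppr_eq0 oner_eq0.
exact: oner_neq0.
Qed.
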